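(* Let $\mathbb{F}$ be a field of characteristic not $2$, and let $i$ be an element of $\mathbb{F}$ such that $i^2=-1$. Let $A\in\mathrm{GL}_n(\mathbb{F})$, and let $r\geq n$ be an integer such that $i^r\det A=\pm 1$. Then the matrix $A\oplus(i\,I_r)\in\mathrm{GL}_{n+r}(\mathbb{F})$ is the product of three involutions.
   Context: $A\oplus B$ denotes the block-diagonal matrix with diagonal blocks $A$ and $B$. A matrix $S\in\mathrm{GL}_m(\mathbb{F})$ is an involution if $S^2=I_m$ (so $I_m$ is an involution). *)

(* Defs.v *)
From mathcomp Require Import all_boot all_order all_algebra.
Set Implicit Arguments.
Unset Strict Implicit.
Unset Printing Implicit Defensive.
Import GRing.Theory.
Local Open Scope ring_scope.

Definition mx_involution (F : fieldType) (m : nat) (S : 'M[F]_m) : Prop :=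
  S \in unitmx /\ S *m S = 1%:M.

Definition mx_dsum (F : fieldType) (m n : nat) (A : 'M[F]_m) (B : 'M[F]_n)
  : 'M[F]_(m + n) := block_mx A 0 0 B.

(* Main.v *)
Require Import Defs.
From mathcomp Require Import all_boot all_order all_algebra.
From mathcomp Require Import ring.
Set Implicit Arguments.
Unset Strict Implicit.
Unset Printing Implicit Defensive.
Import GRing.Theory.
Local Open Scope ring_scope.

(** Write M for the direct sum of A and i I_r.  It is enough to find an
    involution S such that S M is, up to similarity, a product of two
    involutions; and direct sums of products of two, or of three, involutions
    are such products again.

    Fitting's lemma for A - i splits A into a part A1 on which A - i is nilpotent
    and a part A2 on which A - i is invertible; each part takes as many copies of
    i as its size, and the other copies are paired off: i I_2 is the product of
    diag(1,-1) and diag(i,-i), and the latter is conjugate to its inverse.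

    For A1 = i U with U unipotent, U is a product R S of two involutions
    ([unipotent_two_inv], by splitting off cyclic summands), and swapping the two
    halves turns the direct sum of i U and i into an explicit product of two
    involutions ([three_inv_swap]).

    For A2, of size n, the involution with blocks P, 1, 1 - P^2, -P turns the
    direct sum of A2 and i I_n into a matrix similar to [[Y, 1], [0, X]], for
    all X and Y such that X Y = - i A2: such an involution exists because
    P (A2 - i) = X + Y can be solved for P ([flips_frame]).  Put
    C = - i A2 and d = det C; the hypothesis on det A says that d^2 = 1 when an
    even number of copies of i is left, and that d^2 = -1 when an odd number is
    left.

    If C is not scalar, it is conjugate to X Y with X unipotent and Y block
    triangular, with d and a unipotent matrix as diagonal blocks, by the argument
    of Sourour's factorization theorem ([nonscalar_schur], [unipotent_factors]).
    Then [[Y, 1], [0, X]] is unipotent if d = 1, and otherwise it is the direct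
    sum of (d) and a unipotent matrix.

    If C is the scalar c, take X diagonal with entries s c^(-k) and Y = c X^(-1).
    The entries s^(-1) c^(k+1) of Y and s c^(-(k+1)) of X are inverse to each
    other, so that only the two ends s and s^(-1) d of this chain are left over.
    With s = 1, or s = i if some odd power of c of exponent less than 2n is 1,
    X and Y have no common entry in the same place, hence [[Y, 1], [0, X]] is
    diagonalizable ([scalar_zigzag]).

    In both cases what is left over is at most the 1 x 1 block d.  If d^2 = 1 it
    is an involution.  If d^2 = -1, a spare copy of i is turned into -d, which is
    the inverse of d, by multiplying it with i d = 1 or -1. *)

(** * Similarity across sizes, and products of involutions *)

(** Over a field invertibility follows from the equation, so this is the useful
    half of the definition of an involution. *)
Definition involutive_mx (F : fieldType) n (S : 'M[F]_n) := S *m S = 1%:M.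

Definition two_inv (F : fieldType) n (K : 'M[F]_n) :=
  exists S1 S2, [/\ involutive_mx S1, involutive_mx S2 & K = S1 *m S2].

(** Since S is its own inverse, this says that K is S times a product of two
    involutions. *)
Definition three_inv (F : fieldType) n (K : 'M[F]_n) :=
  exists2 S, involutive_mx S & two_inv (S *m K).

(** Matrices of sizes n and m are compared through a mutually inverse pair of
    rectangular matrices, so that n and m need not be convertible.  This avoids
    all casts between 'M_(n1 + n2) and 'M_n when a matrix is split in blocks. *)
Definition simto (F : fieldType) n m (K : 'M[F]_n) (L : 'M[F]_m) :=
  exists G H, [/\ G *m H = 1%:M, H *m G = 1%:M & K = H *m L *m G].

Local Notation "A :+: B" := (block_mx A 0 0 B) (at level 50, left associativity).

Definition nilpotent_mx (F : fieldType) n (N : 'M[F]_n) := exists k, N ^+ k = 0.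

Lemma simto_intertwine (F : fieldType) n m (K : 'M[F]_n) (L : 'M[F]_m) G H :
  G *m H = 1%:M -> H *m G = 1%:M -> G *m K = L *m G -> simto K L.
Proof.
by move=> GH HG GK; exists G, H; split=> //; rewrite -mulmxA -GK mulmxA HG mul1mx.
Qed.

Lemma simto_refl (F : fieldType) n (K : 'M[F]_n) : simto K K.
Proof. by exists 1%:M, 1%:M; rewrite !mulmx1 mul1mx. Qed.

Lemma simto_sym (F : fieldType) n m (K : 'M[F]_n) (L : 'M[F]_m) :
  simto K L -> simto L K.
Proof.
case=> G [H [GH HG ->]]; exists H, G; split=> //.
by rewrite -!mulmxA GH mulmx1 mulmxA GH mul1mx.
Qed.

Lemma simto_trans (F : fieldType) n m p (K : 'M[F]_n) (L : 'M[F]_m)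
    (M : 'M[F]_p) : simto K L -> simto L M -> simto K M.
Proof.
case=> G [H [GH HG ->]] [G' [H' [GH' HG' ->]]].
exists (G' *m G), (H *m H'); split; last by rewrite !mulmxA.
  by rewrite mulmxA -(mulmxA G') GH mulmx1.
by rewrite mulmxA -(mulmxA H) HG' mulmx1.
Qed.

Lemma simto_dsum (F : fieldType) n m n' m' (K : 'M[F]_n) (L : 'M[F]_m)
    (K' : 'M[F]_n') (L' : 'M[F]_m') :
  simto K L -> simto K' L' -> simto (K :+: K') (L :+: L').
Proof.
case=> G [H [GH HG ->]] [G' [H' [GH' HG' ->]]].
exists (G :+: G'), (H :+: H').
by split; rewrite !mulmx_block !(mulmx0, mul0mx, addr0, add0r) ?GH ?HG
  ?GH' ?HG' -?scalar_mx_block.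
Qed.

Lemma simto_dsumC (F : fieldType) n m (K : 'M[F]_n) (L : 'M[F]_m) :
  simto (K :+: L) (L :+: K).
Proof.
apply: (@simto_intertwine _ _ _ _ _ (block_mx 0 1%:M 1%:M 0)
  (block_mx 0 1%:M 1%:M 0)).
all: by rewrite !mulmx_block !(mulmx0, mul0mx, addr0, add0r, mulmx1, mul1mx)
  -?scalar_mx_block.
Qed.

Lemma simto_cast (F : fieldType) n m (e e' : n = m) (K : 'M[F]_n) :
  simto K (castmx (e, e') K).
Proof.
by rewrite (eq_irrelevance e' e); case: m / e {e'}; rewrite castmx_id;
  apply: simto_refl.
Qed.

Lemma simto_blockA (F : fieldType) n1 n2 n3
    (A11 : 'M[F]_(n1, n1)) (A12 : 'M_(n1, n2)) (A13 : 'M_(n1, n3))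
    (A21 : 'M_(n2, n1)) (A22 : 'M_(n2, n2)) (A23 : 'M_(n2, n3))
    (A31 : 'M_(n3, n1)) (A32 : 'M_(n3, n2)) (A33 : 'M_(n3, n3)) :
  simto (block_mx A11 (row_mx A12 A13)
                  (col_mx A21 A31) (block_mx A22 A23 A32 A33))
        (block_mx (block_mx A11 A12 A21 A22) (col_mx A13 A23)
                  (row_mx A31 A32) A33).
Proof.
have e := @block_mxA F n1 n2 n3 n1 n2 n3 A11 A12 A13 A21 A22 A23 A31 A32 A33.
by rewrite /= in e; rewrite e; apply: simto_sym (simto_cast _ _ _).
Qed.

Lemma simto_dsumA (F : fieldType) n1 n2 n3
    (K : 'M[F]_n1) (L : 'M[F]_n2) (M : 'M[F]_n3) :
  simto (K :+: (L :+: M)) (K :+: L :+: M).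
Proof.
have := simto_blockA K 0 0 0 L 0 0 0 M.
by rewrite !row_mx0 !col_mx0.
Qed.

Lemma simto_dsumACA (F : fieldType) n1 n2 n3 n4 (K1 : 'M[F]_n1) (K2 : 'M[F]_n2)
    (K3 : 'M[F]_n3) (K4 : 'M[F]_n4) :
  simto (K1 :+: K2 :+: (K3 :+: K4)) (K1 :+: K3 :+: (K2 :+: K4)).
Proof.
apply: simto_trans (simto_sym (simto_dsumA _ _ _)) _.
apply: simto_trans (simto_dsumA _ _ _).
apply: simto_dsum (simto_refl _) _.
apply: simto_trans (simto_dsumA _ _ _) _.
apply: simto_trans (simto_sym (simto_dsumA _ _ _)).
exact: simto_dsum (simto_dsumC _ _) (simto_refl _).
Qed.

Lemma involutive_mx_conj (F : fieldType) n m (S : 'M[F]_n) (G : 'M_(n, m)) H :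
  G *m H = 1%:M -> H *m G = 1%:M ->
  involutive_mx S -> involutive_mx (H *m S *m G).
Proof.
rewrite /involutive_mx => GH HG SS.
by rewrite !mulmxA -[_ *m G *m H]mulmxA GH mulmx1 -[_ *m S *m S]mulmxA SS mulmx1.
Qed.

Lemma two_inv_simto (F : fieldType) n m (K : 'M[F]_n) (L : 'M[F]_m) :
  simto K L -> two_inv L -> two_inv K.
Proof.
case=> G [H [GH HG ->]] [S1 [S2 [i1 i2 ->]]].
exists (H *m S1 *m G), (H *m S2 *m G); split; try exact: involutive_mx_conj.
by rewrite !mulmxA -[_ *m G *m H]mulmxA GH mulmx1.
Qed.

Lemma three_inv_simto (F : fieldType) n m (K : 'M[F]_n) (L : 'M[F]_m) :
  simto K L -> three_inv L -> three_inv K.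
Proof.
case=> G [H [GH HG ->]] [S iS SL].
exists (H *m S *m G); first exact: involutive_mx_conj.
apply: two_inv_simto SL; exists G, H; split=> //.
by rewrite !mulmxA -[_ *m G *m H]mulmxA GH mulmx1.
Qed.

Lemma involutive_dsum (F : fieldType) n m (S : 'M[F]_n) (T : 'M[F]_m) :
  involutive_mx S -> involutive_mx T -> involutive_mx (S :+: T).
Proof.
rewrite /involutive_mx mulmx_block => -> ->.
by rewrite !(mulmx0, mul0mx, addr0, add0r) -scalar_mx_block.
Qed.

Lemma dsum_mul (F : fieldType) n m (K K' : 'M[F]_n) (L L' : 'M[F]_m) :
  (K :+: L) *m (K' :+: L') = (K *m K') :+: (L *m L').
Proof. by rewrite mulmx_block !(mulmx0, mul0mx, addr0, add0r). Qed.

Lemma two_inv_dsum (F : fieldType) n m (K : 'M[F]_n) (L : 'M[F]_m) :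
  two_inv K -> two_inv L -> two_inv (K :+: L).
Proof.
case=> S1 [S2 [i1 i2 ->]] [T1 [T2 [j1 j2 ->]]].
exists (S1 :+: T1), (S2 :+: T2).
by split; try exact: involutive_dsum; rewrite dsum_mul.
Qed.

Lemma three_inv_dsum (F : fieldType) n m (K : 'M[F]_n) (L : 'M[F]_m) :
  three_inv K -> three_inv L -> three_inv (K :+: L).
Proof.
case=> S iS SK [T iT TL]; exists (S :+: T); first exact: involutive_dsum.
by rewrite dsum_mul; apply: two_inv_dsum.
Qed.

Lemma involutive1 (F : fieldType) n : involutive_mx (1%:M : 'M[F]_n).
Proof. exact: mulmx1. Qed.

Lemma two_inv_involutive (F : fieldType) n (S : 'M[F]_n) :
  involutive_mx S -> two_inv S.
Proof.
by move=> iS; exists 1%:M, S; split=> //; [apply: involutive1 | rewrite mul1mx].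
Qed.

Lemma involutive_scalar (F : fieldType) n (e : F) :
  e ^+ 2 = 1 -> involutive_mx (e%:M : 'M_n).
Proof. by rewrite /involutive_mx -scalar_mxM -expr2 => ->. Qed.

(** If an involution R conjugates K to its inverse, then K R is an involution
    too, and K is (K R) R. *)
Lemma two_inv_reversed (F : fieldType) n (K R : 'M[F]_n) :
  involutive_mx R -> K *m R *m K = R -> two_inv K.
Proof.
rewrite /involutive_mx => RR KRK; exists (K *m R), R; split=> //.
  by rewrite /involutive_mx mulmxA KRK.
by rewrite -mulmxA RR mulmx1.
Qed.

(** The involution that exchanges the two summands conjugates K and its inverse
    to one another. *)
Lemma two_inv_dsumV (F : fieldType) n (K L : 'M[F]_n) :
  K *m L = 1%:M -> two_inv (K :+: L).
Proof.
move=> KL; have LK := mulmx1C KL.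
apply: (@two_inv_reversed _ _ _ (block_mx 0 1%:M 1%:M 0)).
  by rewrite /involutive_mx mulmx_block
   !(mulmx0, mul0mx, addr0, add0r, mulmx1) -scalar_mx_block.
by rewrite !mulmx_block !(mulmx0, mul0mx, addr0, add0r, mulmx1) KL LK.
Qed.

(** The rank factorization e = C B of an idempotent satisfies C (B C) B = C B,
    and C and B can be cancelled. *)
Lemma idempotent_base (F : fieldType) n (e : 'M[F]_n) : e *m e = e ->
  row_base e *m col_base e = 1%:M.
Proof.
have [Q CQ] := row_fullP (col_base_full e).
have [P BP] := row_freeP (row_base_free e).
move: (mulmx_base e) CQ BP.
move: (\rank e) (col_base e) (row_base e) Q P => p C B Q P eE CQ BP.
move=> ee; have := congr1 (fun X => Q *m X *m P) ee.
rewrite -eE !mulmxA CQ mul1mx -[_ *m B *m P]mulmxA BP.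
by rewrite mulmx1.
Qed.

(** The rows of B and the columns of C are dual families; C B is the projection
    on the span of B along the annihilator of C, and the rank factorization of
    the complementary projection completes the two families to dual bases. *)
Lemma complete_frame (F : fieldType) n p (B : 'M[F]_(p, n)) C :
  B *m C = 1%:M ->
  exists q (B' : 'M_(q, n)) C',
    [/\ B' *m C' = 1%:M, C *m B + C' *m B' = 1%:M, B *m C' = 0, B' *m C = 0
      & forall K : 'M_n, simto K (block_mx (B *m K *m C) (B *m K *m C')
                                           (B' *m K *m C) (B' *m K *m C'))].
Proof.
move=> BC; pose e := C *m B; pose f := 1%:M - e.
have ee : e *m e = e by rewrite /e mulmxA -[C *m B *m C]mulmxA BC mulmx1.
have ff : f *m f = f by rewrite /f mulmxBl mul1mx mulmxBr mulmx1 ee subrr subr0.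
have Bf : B *m f = 0 by rewrite /f mulmxBr mulmx1 mulmxA BC mul1mx subrr.
have fC : f *m C = 0 by rewrite /f mulmxBl mul1mx -mulmxA BC mulmx1 subrr.
have sum1 : e + f = 1%:M by rewrite addrC subrK.
move: (mulmx_base f) (idempotent_base ff).
move: (\rank f) (row_base f) (col_base f) => q B' C' fE BC'.
have B'C : B' *m C = 0
  by rewrite -[B']mul1mx -BC' -!mulmxA [C' *m _]mulmxA fE fC mulmx0.
have BC'0 : B *m C' = 0
  by rewrite -[C']mulmx1 -BC' !mulmxA -[B *m _ *m _]mulmxA fE Bf mul0mx.
exists q, B', C'; rewrite fE; split=> // K.
apply: (@simto_intertwine _ _ _ _ _ (col_mx B B') (row_mx C C')).
- by rewrite mul_col_row BC BC' BC'0 B'C -scalar_mx_block.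
- by rewrite mul_row_col fE.
- rewrite mul_col_mx mul_block_col -!mulmxA -!mulmxDr fE.
  by rewrite -/e sum1 !mulmx1.
Qed.

(** When the span of B and the annihilator of C are both stable by K, the
    off-diagonal blocks in the completed bases vanish. *)
Lemma frame_split (F : fieldType) n p (K : 'M[F]_n) (B : 'M_(p, n)) C L :
  B *m C = 1%:M -> B *m K = L *m B -> K *m C = C *m L ->
  exists q (B' : 'M_(q, n)) C',
    [/\ B' *m C' = 1%:M, C *m B + C' *m B' = 1%:M, B' *m C = 0
      & simto K (L :+: (B' *m K *m C'))].
Proof.
move=> BC BK KC; have [q [B' [C' [BC' sum1 BC'0 B'C sim]]]] := complete_frame BC.
exists q, B', C'; split=> //; have := sim K.
by rewrite BK -!mulmxA BC mulmx1 BC'0 mulmx0 KC !mulmxA B'C mul0mx.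
Qed.

(** * Nilpotent matrices *)

Lemma simto_size (F : fieldType) n m (K : 'M[F]_n) (L : 'M[F]_m) :
  simto K L -> n = m.
Proof.
case=> G [H [GH HG _]]; apply/eqP.
by rewrite eqn_leq (mulmx1_min HG) (mulmx1_min GH).
Qed.

Lemma simto_pow (F : fieldType) n m (K : 'M[F]_n) (L : 'M[F]_m) k :
  simto K L -> simto (K ^+ k) (L ^+ k).
Proof.
case=> G [H [GH HG ->]]; exists G, H; split=> //.
elim: k => [|k IHk]; first by rewrite !expr0 mulmx1.
rewrite !exprS IHk -!mulmxE !mulmxA.
by rewrite -[_ *m G *m H]mulmxA GH mulmx1.
Qed.

Lemma simto_scalarD (F : fieldType) n m a (K : 'M[F]_n) (L : 'M[F]_m) :
  simto K L -> simto (a%:M + K) (a%:M + L).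
Proof.
case=> G [H [GH HG ->]]; exists G, H; split=> //.
by rewrite mulmxDr mulmxDl mul_mx_scalar -scalemxAl HG scalemx1.
Qed.

Lemma simto0 (F : fieldType) n m (K : 'M[F]_n) :
  simto K (0 : 'M[F]_m) -> K = 0.
Proof. by case=> G [H [_ _ ->]]; rewrite mulmx0 mul0mx. Qed.

Lemma nilpotent_simto (F : fieldType) n m (K : 'M[F]_n) (L : 'M[F]_m) :
  simto K L -> nilpotent_mx L -> nilpotent_mx K.
Proof.
move=> sKL [k Lk]; exists k; apply/(@simto0 _ _ m).
by rewrite -Lk; apply: simto_pow.
Qed.

Lemma block_powE (F : fieldType) n m (K : 'M[F]_n) (u : 'M_(n, m)) (L : 'M[F]_m) k :
  exists u', block_mx K u 0 L ^+ k = block_mx (K ^+ k) u' 0 (L ^+ k).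
Proof.
elim: k => [|k [u' IHk]]; first by exists 0; rewrite !expr0 -scalar_mx_block.
rewrite !exprS IHk -!mulmxE mulmx_block !(mul0mx, mulmx0, addr0, add0r).
by eexists.
Qed.

Lemma nilpotent_ublock (F : fieldType) n m (K : 'M[F]_n) (u : 'M_(n, m)) (L : 'M[F]_m) :
  nilpotent_mx K -> nilpotent_mx L -> nilpotent_mx (block_mx K u 0 L).
Proof.
move=> [a Ka] [b Lb]; exists (a + b)%N; rewrite exprD -mulmxE.
have [u1 ->] := block_powE K u L a; have [u2 ->] := block_powE K u L b.
by rewrite Ka Lb mulmx_block !(mul0mx, mulmx0, addr0, add0r) block_mx0.
Qed.

Lemma trmx_pow (F : fieldType) n (K : 'M[F]_n) k : (K ^+ k)^T = K^T ^+ k.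
Proof.
elim: k => [|k IHk]; first by rewrite !expr0 trmx1.
by rewrite exprS exprSr -!mulmxE trmx_mul IHk.
Qed.

Lemma nilpotent_tr (F : fieldType) n (K : 'M[F]_n) : nilpotent_mx K -> nilpotent_mx K^T.
Proof. by case=> k Kk; exists k; rewrite -trmx_pow Kk trmx0. Qed.

Lemma nilpotent_lblock (F : fieldType) n m (K : 'M[F]_n) (u : 'M_(m, n)) (L : 'M[F]_m) :
  nilpotent_mx K -> nilpotent_mx L -> nilpotent_mx (block_mx K 0 u L).
Proof.
move=> nK nL; rewrite -[block_mx _ _ _ _]trmxK tr_block_mx trmx0.
exact/nilpotent_tr/nilpotent_ublock/nilpotent_tr/nL/nilpotent_tr.
Qed.

Lemma nilpotent_dsum (F : fieldType) n m (K : 'M[F]_n) (L : 'M[F]_m) :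
  nilpotent_mx (K :+: L) -> nilpotent_mx K /\ nilpotent_mx L.
Proof.
case=> k; have [u ->] := block_powE K 0 L k.
by rewrite -block_mx0 => /eq_block_mx[Kk _ _ Lk]; split; exists k.
Qed.

(** From N^k = 0, a - N divides a^k - N^k = a^k. *)
Lemma nilpotent_scalarB_unit (F : fieldType) n (N : 'M[F]_n) a :
  a != 0 -> nilpotent_mx N -> a%:M - N \in unitmx.
Proof.
move=> a0 [k Nk]; have := @subrXX_comm _ a%:M N k (esym (scalar_mxC _ _)).
rewrite Nk subr0; set s := \sum_(i < k) _ => e.
have ak : (a%:M : 'M[F]_n) ^+ k = (a ^+ k)%:M.
  by elim: k {Nk s e} => // k IHk; rewrite !exprS IHk -mulmxE -scalar_mxM.
suff : (a%:M - N) *m (s *m (a ^- k)%:M) = 1%:M by case/mulmx1_unit.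
by rewrite mulmxA mulmxE -e -mulmxE ak -scalar_mxM divff ?expf_neq0.
Qed.

Lemma unipotent_unit (F : fieldType) n (N : 'M[F]_n) :
  nilpotent_mx N -> 1%:M + N \in unitmx.
Proof.
move=> [k Nk]; rewrite -[N]opprK; apply: nilpotent_scalarB_unit; first exact: oner_neq0.
by exists k; rewrite exprNn Nk mulr0.
Qed.

Lemma mulmx_pow_intertwine (F : fieldType) n m (G : 'M[F]_(m, n))
    (K : 'M[F]_n) (L : 'M[F]_m) j :
  G *m K = L *m G -> G *m K ^+ j = L ^+ j *m G.
Proof.
move=> GK; elim: j => [|j IHj]; first by rewrite !expr0 mulmx1 mul1mx.
by rewrite !exprSr -!mulmxE mulmxA IHj -mulmxA GK mulmxA.
Qed.

(** * Unipotent matrices are products of two involutions *)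

(** With K = 1 + N and N' = K^(-1) - 1, the linear map R that sends v N^j to
    v N'^j is well defined since N^k = N'^k = 0.  It intertwines N with N', and
    so it conjugates K to its inverse; it is an involution since it fixes v and
    also intertwines N' with N. *)
Lemma cyclic_unipotent_two_inv (F : fieldType) k (N : 'M[F]_k) (v : 'rV_k) :
  N ^+ k = 0 -> \matrix_(j < k) (v *m N ^+ j) \in unitmx -> two_inv (1%:M + N).
Proof.
move=> Nk; set Q := \matrix_(j < k) _ => Qu.
pose K := 1%:M + N; rewrite -/K.
have Ku : K \in unitmx by apply: unipotent_unit; exists k.
pose V := invmx K; pose N' := V - 1%:M.
have KV : K *m V = 1%:M := mulmxV Ku.
have VK : V *m K = 1%:M := mulVmx Ku.
have N'E : N' = - (N *m V).
  by rewrite /N' -KV -[X in X - _]mul1mx -mulmxBl /K opprD addNKr mulNmx.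
have cNV : N *m V = V *m N.
  have -> : N = K - 1%:M by rewrite /K addrC addKr.
  by rewrite mulmxBl mulmxBr KV VK mulmx1 mul1mx.
have N'k : N' ^+ k = 0.
  by rewrite N'E exprNn mulmxE exprMn_comm // Nk mul0r mulr0.
pose Q' := \matrix_(j < k) (v *m N' ^+ j).
pose R := invmx Q *m Q'.
(* Both sides vanish for j >= k, so this holds for every j. *)
have vR j : v *m N ^+ j *m R = v *m N' ^+ j.
  have [jk|kj] := ltnP j k.
    have -> : v *m N ^+ j = row (Ordinal jk) Q by rewrite rowK.
    by rewrite -row_mul mulmxA mulmxV // mul1mx rowK.
  by rewrite -(subnK kj) !exprD Nk N'k !mulr0 mulmx0 mul0mx.
have ext (X Y : 'M[F]_k) :
    (forall j, v *m N ^+ j *m X = v *m N ^+ j *m Y) -> X = Y.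
  move=> eXY; apply: (can_inj (mulKmx Qu)); apply/row_matrixP => j.
  by rewrite !row_mul rowK eXY.
move: R vR => R vR.
have NR : N *m R = R *m N'.
  apply: ext => j; rewrite !mulmxA vR.
  have := vR j.+1; rewrite !exprSr -!mulmxE !mulmxA => ->.
  by [].
have KR : K *m R = R *m V.
  have -> : V = 1%:M + N' by rewrite addrC subrK.
  by rewrite mulmxDl mulmxDr NR mul1mx mulmx1.
have RK : R *m K = V *m R.
  rewrite -[LHS]mul1mx -{1}VK -!mulmxA [K *m (R *m K)]mulmxA KR.
  by rewrite -[R *m V *m K]mulmxA VK mulmx1.
have RN : N' *m R = R *m N.
  have -> : N = K - 1%:M by rewrite /K addrC addKr.
  by rewrite mulmxBl mulmxBr RK mul1mx mulmx1.
apply: (@two_inv_reversed _ _ _ R); last by rewrite KR -mulmxA VK mulmx1.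
apply: ext => j; rewrite mulmxA vR mulmx1 -mulmxA.
rewrite -(mulmx_pow_intertwine j (esym RN)) in vR *.
have := vR 0%N; rewrite !expr0 !mulmx1 mulmxA => ->.
by [].
Qed.

(** If B and C span spaces stable by N, and B C is invertible, then the rows of
    B can be changed into the basis G dual to the columns of C. *)
Lemma dual_frames (F : fieldType) n k (N : 'M[F]_n) (B : 'M_(k, n)) C L L' :
  B *m C \in unitmx -> B *m N = L *m B -> N *m C = C *m L' ->
  exists2 G : 'M_(k, n), G *m C = 1%:M & G *m N = L' *m G.
Proof.
set T := B *m C => Tu BN NC.
have LT : L *m T = T *m L' by rewrite mulmxA -BN -!mulmxA NC.
exists (invmx T *m B); first by rewrite -mulmxA mulVmx.
rewrite -mulmxA BN !mulmxA; congr (_ *m B).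
by rewrite -[LHS]mulmx1 -(mulmxV Tu) mulmxA -[_ *m L *m T]mulmxA LT mulKmx.
Qed.

(** This is the induction step of the Jordan decomposition of nilpotent
    matrices.  With k minimal such that N^k = 0, choose v and phi such that
    v N^(k-1) phi = 1.  The rows v N^s and the columns N^(k-1-t) phi pair
    by a unitriangular matrix, so that the span of the v N^s has a stable
    complement. *)
Lemma nilpotent_cyclic_split (F : fieldType) n (N : 'M[F]_n) :
  (0 < n)%N -> nilpotent_mx N ->
  exists k q (N2 : 'M_k) (N3 : 'M_q) (v : 'rV_k),
    [/\ (0 < k)%N, simto N (N2 :+: N3), N2 ^+ k = 0
      & \matrix_(j < k) (v *m N2 ^+ j) \in unitmx].
Proof.
move=> n0 nN.
have exk : exists k, N ^+ k == 0 by case: nN => k Nk; exists k; apply/eqP.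
case: (ex_minnP exk) => -[|k'].
  rewrite expr0 => /eqP /matrixP /(_ (Ordinal n0) (Ordinal n0)).
  by rewrite !mxE eqxx => /eqP; rewrite oner_eq0.
set k := k'.+1 => /eqP Nk kmin.
have Nk' : N ^+ k' != 0 by apply/negP => /kmin; rewrite ltnn.
have Nge j : (k <= j)%N -> N ^+ j = 0.
  by move=> kj; rewrite -(subnK kj) exprD Nk mulr0.
have [v [phi v1]] : exists (v : 'rV_n) (phi : 'cV_n),
    v *m N ^+ k' *m phi = 1%:M.
  have [i [j aij]] : exists i j, (N ^+ k') i j != 0.
    have [/existsP[i /existsP[j a]]|] :=
      boolP [exists i, exists j, (N ^+ k') i j != 0]; first by exists i, j.
    rewrite negb_exists => /forallP a0; case/eqP: Nk'.
    apply/matrixP => i j; rewrite mxE; have := a0 i; rewrite negb_exists.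
    by move/forallP/(_ j); rewrite negbK => /eqP.
  exists (delta_mx 0 i), (((N ^+ k') i j)^-1 *: delta_mx j 0).
  rewrite -scalemxAr -rowE -colE; apply/matrixP => s t.
  by rewrite !mxE !ord1 eqxx mulVf.
pose B := \matrix_(s < k) (v *m N ^+ s).
pose C := \matrix_(s < n, t < k) (N ^+ (k' - t) *m phi) s 0.
have colC t : col t C = N ^+ (k' - t) *m phi.
  by apply/matrixP => s u; rewrite !mxE !ord1.
pose T := B *m C.
have TE s t : T s t = (v *m N ^+ (s + (k' - t)) *m phi) 0 0.
  have -> : T s t = (row s B *m col t C) 0 0.
    by rewrite !mxE; apply: eq_bigr => u _; rewrite !mxE.
  by rewrite rowK colC exprD -mulmxE !mulmxA.
have Tu : T \in unitmx.
  rewrite -unitmx_tr unitmxE det_trig.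
    rewrite big1 ?unitr1 // => s _; rewrite mxE TE subnKC ?v1 ?mxE //.
    by rewrite -ltnS.
  apply/is_trig_mxP => s t st; rewrite mxE TE Nge ?mulmx0 ?mul0mx ?mxE //.
  have : (s <= k')%N by rewrite -ltnS.
  by move=> sk; rewrite /k -{1}(subnKC sk) -addSn leq_add2r.
have [L BN] : exists L, B *m N = L *m B.
  apply/submxP/row_subP => s; rewrite row_mul rowK -mulmxA mulmxE -exprSr.
  have [sk|/Nge ->] := ltnP s.+1 k; last by rewrite mulmx0 sub0mx.
  by rewrite -[X in (X <= _)%MS](rowK (fun s : 'I_k => v *m N ^+ s) (Ordinal sk)) row_sub.
have [L' NC] : exists L', N *m C = C *m L'.
  have /submxP[D eD] : (C^T *m N^T <= C^T)%MS.
    apply/row_subP => t; rewrite row_mul -tr_col colC -trmx_mul mulmxA mulmxE -exprS.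
    case: (posnP t) => [->|t0].
      by rewrite subn0 Nk mul0mx trmx0 sub0mx.
    have tk : (t.-1 < k)%N by apply: leq_ltn_trans (leq_pred _) (ltn_ord t).
    have -> : ((k' - t).+1 = k' - Ordinal tk)%N.
      by rewrite /= -subSn ?prednK //; case: t t0 {tk} => -[].
    by rewrite -colC tr_col row_sub.
  by exists D^T; rewrite -[LHS]trmxK trmx_mul eD trmx_mul trmxK.
have [G GC GN] := dual_frames Tu BN NC.
have [q [B' [C' [_ _ _ sN]]]] := frame_split GC GN NC.
exists k, q, L', (B' *m N *m C'), (v *m C); split=> //.
  by rewrite -[LHS]mulmx1 -GC mulmxA -(mulmx_pow_intertwine k GN) Nk mulmx0 mul0mx.
suff -> : \matrix_(j < k) (v *m C *m L' ^+ j) = T by [].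
apply/row_matrixP => j; rewrite rowK row_mul rowK -!mulmxA.
by rewrite (mulmx_pow_intertwine _ (esym NC)).
Qed.

Lemma unipotent_two_inv (F : fieldType) n (N : 'M[F]_n) :
  nilpotent_mx N -> two_inv (1%:M + N).
Proof.
elim/ltn_ind: n N => n IHn N nN.
have [n0|n0] := posnP n.
  by subst n; apply: two_inv_involutive; rewrite /involutive_mx !flatmx0.
have [k [q [N2 [N3 [v [k0 sN N2k Qu]]]]]] := nilpotent_cyclic_split n0 nN.
apply: two_inv_simto (simto_scalarD 1 sN) _.
rewrite scalar_mx_block add_block_mx !addr0.
apply: two_inv_dsum; first exact: cyclic_unipotent_two_inv N2k Qu.
apply: IHn.
  by rewrite (simto_size sN) -{1}[q]add0n ltn_add2r.
exact: (nilpotent_dsum (nilpotent_simto (simto_sym sN) nN)).2.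
Qed.

(** * Fitting decomposition and the frame of an involution *)

(** Otherwise the ranks of the powers N^1, N^2, N^4, ... would decrease
    forever. *)
Lemma rank_pow_stable (F : fieldType) n (N : 'M[F]_n) :
  exists2 j, (0 < j)%N & \rank (N ^+ j *m N ^+ j) = \rank (N ^+ j).
Proof.
suff H m j : (\rank (N ^+ j) <= m)%N -> (0 < j)%N ->
    exists2 j, (0 < j)%N & \rank (N ^+ j *m N ^+ j) = \rank (N ^+ j).
  exact: (H (\rank (N ^+ 1)) 1%N).
elim/ltn_ind: m j => m IHm j jm j0.
have := mxrankM_maxl (N ^+ j) (N ^+ j); rewrite leq_eqVlt => /orP[/eqP ej | lt].
  by exists j.
apply: (IHm (\rank (N ^+ (j + j))) _ (j + j)%N) => //; last by rewrite addn_gt0 j0.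
by rewrite exprD -mulmxE; apply: leq_trans lt jm.
Qed.

(** If Z = N^j and Z^2 have the same rank and Z = C B is a rank factorization,
    then B C is invertible.  The span of B, on which N is invertible, thus has
    the annihilator of C, that is the kernel of Z, as a complement. *)
Lemma fitting_split (F : fieldType) n (N : 'M[F]_n) :
  exists p q (N1 : 'M_p) (N2 : 'M_q),
    [/\ simto N (N1 :+: N2), nilpotent_mx N1 & N2 \in unitmx].
Proof.
have [j j0] := rank_pow_stable N; set Z := N ^+ j.
have ZN : Z *m N = N *m Z by rewrite mulmxE -exprS -exprSr.
have [Q CQ] := row_fullP (col_base_full Z).
have [P BP] := row_freeP (row_base_free Z).
move: (col_base_full Z) (row_base_free Z) (mulmx_base Z) CQ BP.
move: (\rank Z) (col_base Z) (row_base Z) Q P => r C B Q P Cf Bf ZE CQ BP rZ.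
have Tu : B *m C \in unitmx.
  rewrite -row_full_unit /row_full -[X in _ == X]rZ -ZE.
  by rewrite eq_sym mulmxA mxrankMfree // -mulmxA (eqmxMfull _ Cf).
have BN : B *m N = (Q *m N *m C) *m B.
  by rewrite -!mulmxA ZE -ZN -ZE !mulmxA CQ mul1mx.
have NC : N *m C = C *m (B *m N *m P).
  by rewrite !mulmxA ZE ZN -ZE -!mulmxA BP mulmx1.
have [G GC GN] := dual_frames Tu BN NC.
have [q [B' [C' [BC' sum1 BC0 sN]]]] := frame_split GC GN NC.
exists q, r, (B' *m N *m C'), (B *m N *m P); split.
- exact: simto_trans sN (simto_dsumC _ _).
- have B'N : B' *m N = B' *m N *m C' *m B'.
    rewrite -[LHS]mulmx1 -sum1 mulmxDr !mulmxA -[B' *m N *m C]mulmxA NC.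
    by rewrite !mulmxA BC0 !mul0mx add0r.
  exists j; rewrite -[LHS]mulmx1 -BC' mulmxA -(mulmx_pow_intertwine j B'N).
  by rewrite -/Z -ZE !mulmxA BC0 !mul0mx.
- have : (B *m N *m P) ^+ j \in unitmx.
    rewrite -[_ ^+ j]mulmx1 -GC mulmxA -(mulmx_pow_intertwine j GN).
    rewrite -/Z -ZE !mulmxA GC mul1mx; exact: Tu.
  by case: j j0 {Z ZN ZE rZ} => // j _; rewrite exprS -mulmxE unitmx_mul => /andP[].
Qed.

(** With K = R S, swapping the two halves gives [[0, i], [i R S, 0]], which is
    the product of the involutions [[0, -i R], [i R, 0]] and diag(S, -R). *)
Lemma three_inv_swap (F : fieldType) (i : F) n (K : 'M[F]_n) :
  i ^+ 2 = -1 -> two_inv K -> three_inv (i *: K :+: (i%:M : 'M_n)).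
Proof.
move=> i2 [R [S [RR SS ->]]].
exists (block_mx 0 1%:M 1%:M 0).
  by rewrite /involutive_mx mulmx_block
   !(mulmx0, mul0mx, addr0, add0r, mulmx1) -scalar_mx_block.
have ii : i * i = -1 by rewrite -expr2.
exists (block_mx 0 (- i *: R) (i *: R) 0), (S :+: - R).
have RR' : R *m R = 1%:M := RR.
split.
- rewrite /involutive_mx mulmx_block !(mulmx0, mul0mx, addr0, add0r).
  by rewrite -!scalemxAl -!scalemxAr RR' !scalerA mulrN mulNr ii opprK !scale1r
    -scalar_mx_block.
- by apply: involutive_dsum => //; rewrite /involutive_mx mulmxN mulNmx opprK.
- rewrite !mulmx_block !(mulmx0, mul0mx, addr0, add0r, mul1mx).
  by rewrite mulmxN scaleNr mulNmx opprK -!scalemxAl RR' scalemx1.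
Qed.

(** The basis change [[1, 0], [P A - Y, i]] is the product of two: the first
    clears the upper left block of the matrix and leaves the block companion
    matrix [[0, 1], [i A, P (A - i)]]; the second is the analogous one for
    [[Y, 1], [0, X]], which is similar to [[0, 1], [- X Y, X + Y]]. *)
Lemma frame_simto (F : fieldType) (i : F) n (A X Y P : 'M[F]_n) :
  i ^+ 2 = -1 -> X *m Y = - (i *: A) -> P *m (A - i%:M) = X + Y ->
  simto (block_mx P 1%:M (1%:M - P *m P) (- P) *m (A :+: i%:M))
        (block_mx Y 1%:M 0 X).
Proof.
move=> i2 XY PA.
have ii : i * i = -1 by rewrite -expr2.
have XE : X = P *m A - i *: P - Y.
  by rewrite -mul_mx_scalar -mulmxBr PA addrK.
apply: (@simto_intertwine _ _ _ _ _
  (block_mx 1%:M 0 (P *m A - Y) i%:M)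
  (block_mx 1%:M 0 (i *: (P *m A - Y)) (- i)%:M)).
- rewrite mulmx_block !(mulmx0, mul0mx, addr0, add0r, mulmx1, mul1mx).
  rewrite mul_scalar_mx scalerA ii scaleN1r subrr -scalar_mxM mulrN ii opprK.
  by rewrite -scalar_mx_block.
- rewrite mulmx_block !(mulmx0, mul0mx, addr0, add0r, mulmx1, mul1mx).
  rewrite mul_scalar_mx scaleNr subrr -scalar_mxM mulNr ii opprK.
  by rewrite -scalar_mx_block.
rewrite !mulmx_block !(mulmx0, mul0mx, addr0, add0r, mulmx1, mul1mx).
rewrite !mul_scalar_mx !mul_mx_scalar.
congr block_mx.
- by rewrite addrC subrK.
- rewrite mulmxBr XY opprK [X in _ = X *m _ + _]XE.
  rewrite [(1%:M - _) *m A]mulmxBl mul1mx scalerBr [P *m A - i *: P - Y]addrAC.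
  rewrite [(_ - i *: P) *m _]mulmxBl -scalemxAl !mulmxA -!addrA.
  by congr (_ + _); apply: addrC.
- by rewrite -scalerDr XE scalerN addrAC.
Qed.

Lemma frame_involution (F : fieldType) n (P : 'M[F]_n) :
  involutive_mx (block_mx P 1%:M (1%:M - P *m P) (- P)).
Proof.
have c : P *m (1%:M - P *m P) = (1%:M - P *m P) *m P.
  by rewrite mulmxBr mulmxBl mulmx1 mul1mx mulmxA.
rewrite /involutive_mx mulmx_block !mulmx1 !mul1mx !mulNmx mulmxN opprK c.
by rewrite !subrr [P *m P + _]addrC subrK -scalar_mx_block.
Qed.

(** * Factoring a nonscalar matrix into unipotent matrices *)

Definition unipotent_mx (F : fieldType) n (U : 'M[F]_n) :=
  nilpotent_mx (U - 1%:M).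

Lemma unipotent_mx_two_inv (F : fieldType) n (U : 'M[F]_n) :
  unipotent_mx U -> two_inv U.
Proof. by move/unipotent_two_inv; rewrite addrC subrK. Qed.

Lemma unipotent1 (F : fieldType) n : unipotent_mx (1%:M : 'M[F]_n).
Proof. by exists 1%N; rewrite subrr expr1. Qed.

Lemma unipotent_simto (F : fieldType) n m (K : 'M[F]_n) (L : 'M[F]_m) :
  simto K L -> unipotent_mx L -> unipotent_mx K.
Proof.
move=> s; apply: nilpotent_simto; have := simto_scalarD (-1) s.
by rewrite ![_%:M + _]addrC !raddfN.
Qed.

Lemma unipotent_ublock (F : fieldType) n m (K : 'M[F]_n) (u : 'M_(n, m)) (L : 'M[F]_m) :
  unipotent_mx K -> unipotent_mx L -> unipotent_mx (block_mx K u 0 L).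
Proof.
rewrite /unipotent_mx scalar_mx_block opp_block_mx add_block_mx !oppr0 !addr0.
exact: nilpotent_ublock.
Qed.

Lemma unipotent_lblock (F : fieldType) n m (K : 'M[F]_n) (u : 'M_(m, n)) (L : 'M[F]_m) :
  unipotent_mx K -> unipotent_mx L -> unipotent_mx (block_mx K 0 u L).
Proof.
rewrite /unipotent_mx scalar_mx_block opp_block_mx add_block_mx !oppr0 !addr0.
exact: nilpotent_lblock.
Qed.

Lemma simto_det (F : fieldType) n m (K : 'M[F]_n) (L : 'M[F]_m) :
  simto K L -> \det K = \det L.
Proof.
move=> s; have e := simto_size s; subst m; case: s => G [H [_ HG ->]].
by rewrite !det_mulmx mulrAC -det_mulmx HG det1 mul1r.
Qed.

(** A nonscalar C has a row vector v that is not an eigenvector, and then the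
    values v h = 1 and v C h = b can be prescribed independently.  A vector of
    the canonical basis serves as v if C is not diagonal, and a sum of two such
    vectors if C is diagonal. *)
Lemma nonscalar_frame (F : fieldType) n (C : 'M[F]_n) b :
  ~~ is_scalar_mx C ->
  exists (v : 'rV_n) (h : 'cV_n),
    [/\ v *m h = 1%:M, v *m C *m h = b%:M & v *m C != b *: v].
Proof.
move=> nsC.
have [/existsP[i /existsP[j /andP[ij Cij]]]|] :=
    boolP [exists i, exists j, (i != j) && (C i j != 0)].
  pose t := (b - C i i) / C i j.
  exists (delta_mx 0 i), (delta_mx i 0 + t *: delta_mx j 0); split.
  - apply/matrixP => x y; rewrite -rowE !mxE !ord1 !eqxx (negPf ij) !andbT /=.
    by rewrite mulr0 addr0.
  - rewrite mulmxDr -scalemxAr -!mulmxA -!colE -!rowE.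
    apply/matrixP => x y; rewrite !mxE !ord1 eqxx.
    by rewrite /t divfK // addrC subrK.
  - apply/eqP => /matrixP/(_ 0 j); rewrite -rowE !mxE eqxx /= eq_sym (negPf ij).
    by rewrite mulr0; apply/eqP.
rewrite negb_exists => /forallP Cd.
have Cod i j : i != j -> C i j = 0.
  move=> ij; have := Cd i; rewrite negb_exists => /forallP/(_ j).
  by rewrite ij /= negbK => /eqP.
have [/existsP[i /existsP[j Cij]]|] := boolP [exists i, exists j, C i i != C j j].
  have ij : i != j by apply: contraNneq Cij => ->.
  have ji : j != i by rewrite eq_sym.
  pose s := (b - C j j) / (C i i - C j j).
  have vC x : ((delta_mx 0 i + delta_mx 0 j : 'rV_n) *m C) 0 x = C i x + C j x.
    by rewrite mulmxDl -!rowE !mxE.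
  exists (delta_mx 0 i + delta_mx 0 j), (s *: delta_mx i 0 + (1 - s) *: delta_mx j 0).
  split.
  - rewrite mulmxDl -!rowE; apply/matrixP => x y; rewrite !mxE !ord1 !eqxx.
    by rewrite (negPf ij) (negPf ji) /=; ring.
  - rewrite mulmxDr -!scalemxAr -!colE; apply/matrixP => x y.
    rewrite ord1 (ord1 y) mxE [X in X + _]mxE [X in _ + X]mxE.
    rewrite [X in s * X]mxE [X in _ + (1 - s) * X]mxE !vC.
    rewrite (Cod i j) ?(Cod j i) // mxE eqxx.
    rewrite /s mulr1n add0r addr0. by field; rewrite subr_eq0.
  - apply: contraNneq Cij => /matrixP e; have := e 0 i; have := e 0 j.
    rewrite !vC !mxE !eqxx (negPf ij) (negPf ji) (Cod i j) // (Cod j i) //=.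
    by rewrite !add0r !addr0 => -> ->.
rewrite negb_exists => /forallP Ce; case/negP: nsC; apply/is_scalar_mxP.
have [n0|n0] := posnP n; first by subst n; exists 0; rewrite !flatmx0.
exists (C (Ordinal n0) (Ordinal n0)); apply/matrixP => i j; rewrite mxE.
have [<-|ij] := eqVneq i j; last exact: Cod.
rewrite mulr1n; have := Ce i; rewrite negb_exists => /forallP/(_ (Ordinal n0)).
by rewrite negbK => /eqP.
Qed.

Definition schur (F : fieldType) m (b : F) (r : 'rV_m) (c : 'cV_m) (D : 'M_m) :=
  D - b^-1 *: (c *m r).

Lemma schur_factor (F : fieldType) m (b : F) (r : 'rV_m) (c : 'cV_m) (D X Y : 'M_m) :
  b != 0 -> X *m Y = schur b r c D ->
  block_mx b%:M r c D
    = block_mx 1%:M 0 (b^-1 *: c) X *m block_mx b%:M r 0 Y.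
Proof.
move=> b0 XY; rewrite mulmx_block XY !(mul1mx, mul0mx, mulmx0, addr0).
by rewrite mul_mx_scalar scalerA divff // scale1r -scalemxAl addrC subrK.
Qed.

Lemma det_schur (F : fieldType) m (b : F) (r : 'rV_m) (c : 'cV_m) (D : 'M_m) :
  b != 0 -> \det (block_mx b%:M r c D) = b * \det (schur b r c D).
Proof.
move=> b0; rewrite (@schur_factor _ _ _ _ _ _ 1%:M (schur b r c D)) ?mul1mx //.
by rewrite det_mulmx det_lblock det_ublock !det1 !mul1r det_scalar1.
Qed.

(** Prescribing the upper left entry b is possible by [nonscalar_frame].  If the
    Schur complement is a scalar l, conjugate by [[1, 0], [z, 1]] where z is not
    0 and r z = 0: the entry b does not change, and the Schur complement becomes
    l - (l / b) z r, which is not scalar since z r has square 0 and is not 0.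
    Such a z exists in dimension at least 2. *)
Lemma nonscalar_schur (F : fieldType) n (C : 'M[F]_n) b :
  C \in unitmx -> ~~ is_scalar_mx C -> b != 0 ->
  exists m (r : 'rV_m) (c : 'cV_m) (D : 'M_m),
    simto C (block_mx b%:M r c D) /\
    ((m <= 1)%N \/ ~~ is_scalar_mx (schur b r c D)).
Proof.
move=> Cu nsC b0; have [v [h [vh vCh vC]]] := nonscalar_frame b nsC.
have [m [B' [C' [_ sum1 _ _ sim]]]] := complete_frame vh.
have := sim C; rewrite vCh.
have : v *m C *m C' != 0.
  apply: contraNneq vC => r0.
  by rewrite -[v *m C]mulmx1 -sum1 mulmxDr !mulmxA r0 mul0mx addr0 vCh mul_scalar_mx.
move: (v *m C *m C') (B' *m C *m h) (B' *m C *m C') => r c D r0 sC.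
have [m1|m1] := leqP m 1; first by exists m, r, c, D; split=> //; left.
have [/is_scalar_mxP[l Sl]|nsS] := boolP (is_scalar_mx (schur b r c D)); last first.
  by exists m, r, c, D; split=> //; right.
have l0 : l != 0.
  apply: contraTneq Cu => l0; rewrite unitmxE (simto_det sC) det_schur // Sl l0.
  by rewrite det_scalar expr0n eqn0Ngt (ltn_trans _ m1) // mulr0 unitr0.
have [j rj] : exists j, r 0 j != 0.
  apply/existsP; rewrite -[X in is_true X]negbK negb_exists; apply: contraNN r0.
  move=> /forallP r0; apply/eqP/matrixP => x j; rewrite ord1 mxE.
  by have := r0 j; rewrite negbK => /eqP.
have [i ij] : exists i : 'I_m, i != j.
  apply/existsP; rewrite -[X in is_true X]negbK negb_exists; apply/negP => /forallP e.
  have := e (Ordinal m1); have := e (Ordinal (ltn_trans (ltnSn 0) m1)).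
  by rewrite !negbK => /eqP <-.
pose z : 'cV_m := r 0 j *: delta_mx i 0 - r 0 i *: delta_mx j 0.
have rz : r *m z = 0.
  rewrite mulmxBr -!scalemxAr -!colE; apply/matrixP => x y; rewrite !mxE !ord1.
  by rewrite mulrC subrr.
have zi : z i 0 != 0.
  by rewrite !mxE !eqxx (negPf ij) /= mulr1 mulr0 subr0.
clearbody z.
have DE : D = l%:M + b^-1 *: (c *m r) by rewrite -Sl subrK.
have Dz : D *m z = l *: z.
  by rewrite DE mulmxDl -scalemxAl -mulmxA rz mulmx0 scaler0 addr0 mul_scalar_mx.
exists m, r, (c + l *: z - b *: z), (D - z *m r); split.
  apply: simto_trans sC _.
  apply: (@simto_intertwine _ _ _ _ _ (block_mx 1%:M 0 (- z) 1%:M)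
    (block_mx 1%:M 0 z 1%:M)).
  - by rewrite mulmx_block !(mulmx0, mul0mx, addr0, add0r, mulmx1, mul1mx) addNr
      -scalar_mx_block.
  - by rewrite mulmx_block !(mulmx0, mul0mx, addr0, add0r, mulmx1, mul1mx) subrr
      -scalar_mx_block.
  rewrite !mulmx_block !(mulmx0, mul0mx, addr0, add0r, mulmx1, mul1mx).
  have D'z : (D - z *m r) *m z = l *: z by rewrite mulmxBl Dz -mulmxA rz mulmx0 subr0.
  rewrite !mulmxN D'z rz oppr0 addr0 !mulNmx mul_mx_scalar.
  congr block_mx; last by rewrite addrC.
  by rewrite addrAC addrK addrC.
right; apply/negP => /is_scalar_mxP[u].
have -> : schur b r (c + l *: z - b *: z) (D - z *m r)
    = l%:M + b^-1 *: (c *m r) - z *m r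
      - b^-1 *: (c *m r + l *: (z *m r) - b *: (z *m r)).
  by rewrite /schur DE [(_ - b *: z) *m r]mulmxBl [(c + _) *m r]mulmxDl -!scalemxAl.
have [zr zrE] : exists zr, zr = z *m r by exists (z *m r).
rewrite -zrE; move: (c *m r) => cr e.
have {}e : zr = (b / l * (l - u))%:M.
  apply/matrixP => x y; have := congr1 (fun M : 'M_m => M x y) e.
  rewrite !mxE -mulrnAr mulrnBl => <-; move: (_ *+ _) => d.
  by field; rewrite l0 b0.
have : zr *m z = 0 by rewrite zrE -mulmxA rz mulmx0.
rewrite e mul_scalar_mx => /eqP; rewrite scaler_eq0 => /orP[/eqP k0|/eqP z0].
  move: e; rewrite k0 raddf0 zrE => /matrixP/(_ i j); rewrite !mxE big_ord1 => /eqP.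
  by rewrite mulf_eq0 (negPf zi) (negPf rj).
by rewrite z0 mxE eqxx in zi.
Qed.

(** By induction on n: give the upper left entry the value 1, and factor the
    Schur complement, which has determinant 1 as well. *)
Lemma unipotent_factors (F : fieldType) n (C : 'M[F]_n) :
  \det C = 1 -> (n <= 1)%N \/ ~~ is_scalar_mx C ->
  exists X Y, [/\ unipotent_mx X, unipotent_mx Y & X *m Y = C].
Proof.
elim/ltn_ind: n C => n IHn C C1 hC.
have [n1|n1] := leqP n 1.
  exists 1%:M, 1%:M; split; try exact: unipotent1; rewrite mulmx1.
  case: n n1 C C1 {IHn hC} => [|[|//]] _ C; first by rewrite !flatmx0.
  by rewrite [in _ -> _](mx11_scalar C) det_scalar1 => <-; rewrite -mx11_scalar.
have nsC : ~~ is_scalar_mx C by case: hC => // n1'; rewrite leqNgt n1 in n1'.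
have Cu : C \in unitmx by rewrite unitmxE C1 unitr1.
have [m [r [c [D [sC hS]]]]] := nonscalar_schur Cu nsC (oner_neq0 F).
have S1 : \det (schur 1 r c D) = 1.
  by rewrite -[LHS]mul1r -det_schur ?oner_neq0 // -(simto_det sC).
have mn : (m < n)%N by rewrite (simto_size sC).
have [X [Y [uX uY XY]]] := IHn m mn _ S1 hS.
have e := schur_factor (oner_neq0 F) XY.
case: (sC) => G [H [GH HG CE]].
exists (H *m block_mx 1%:M 0 (1^-1 *: c) X *m G), (H *m block_mx 1%:M r 0 Y *m G).
split.
- apply: (unipotent_simto (L := block_mx 1%:M 0 (1^-1 *: c) X)).
    by exists G, H.
  exact/unipotent_lblock/uX/unipotent1.
- apply: (unipotent_simto (L := block_mx 1%:M r 0 Y)); first by exists G, H.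
  exact/unipotent_ublock/uY/unipotent1.
- by rewrite CE e !mulmxA -[_ *m G *m H]mulmxA GH mulmx1.
Qed.

(** Conjugation by [[1, Z], [0, 1]] clears the upper right block. *)
Lemma sylvester_split (F : fieldType) p n (K : 'M[F]_p) (w : 'M_(p, n)) (L : 'M_n) Z :
  K *m Z = w + Z *m L -> simto (block_mx K w 0 L) (K :+: L).
Proof.
move=> KZ; apply: (@simto_intertwine _ _ _ _ _ (block_mx 1%:M Z 0 1%:M)
  (block_mx 1%:M (- Z) 0 1%:M)).
- by rewrite mulmx_block !(mulmx0, mul0mx, addr0, add0r, mulmx1, mul1mx) addNr
    -scalar_mx_block.
- by rewrite mulmx_block !(mulmx0, mul0mx, addr0, add0r, mulmx1, mul1mx) subrr
    -scalar_mx_block.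
by rewrite !mulmx_block !(mulmx0, mul0mx, addr0, add0r, mulmx1, mul1mx) KZ.
Qed.

Lemma unipotent_eigen_split (F : fieldType) p n (a : F) (w : 'M_(p, n)) (U : 'M_n) :
  a != 1 -> unipotent_mx U ->
  simto (block_mx a%:M w 0 U) ((a%:M : 'M_p) :+: U).
Proof.
move=> a1 uU.
have aUu : a%:M - U \in unitmx.
  have -> : a%:M - U = (a - 1)%:M - (U - 1%:M).
    by rewrite raddfB /= opprB addrA subrK.
  by apply: nilpotent_scalarB_unit; rewrite // subr_eq0.
apply: (@sylvester_split _ _ _ _ _ _ (w *m invmx (a%:M - U))).
by rewrite -[X in _ = X + _](mulmxKV aUu w) mulmxBr mul_mx_scalar mul_scalar_mx subrK.
Qed.

(** * Blocks without the eigenvalue i *)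

(** The relation through which a matrix M is shown to be a product of three
    involutions: K is what is left, up to similarity, after multiplying M by a
    suitable involution. *)
Definition flips (F : fieldType) n p (M : 'M[F]_n) (K : 'M[F]_p) :=
  exists2 S, involutive_mx S & simto (S *m M) K.

Lemma flips_simtol (F : fieldType) n m p (M : 'M[F]_n) (M' : 'M[F]_m) (K : 'M[F]_p) :
  simto M M' -> flips M' K -> flips M K.
Proof.
case=> G [H [GH HG ->]] [S iS SK].
exists (H *m S *m G); first exact: involutive_mx_conj.
apply: simto_trans SK; exists G, H; split=> //.
by rewrite !mulmxA -[_ *m G *m H]mulmxA GH mulmx1.
Qed.

Lemma flips_simtor (F : fieldType) n m p (M : 'M[F]_n) (K : 'M[F]_m) (K' : 'M[F]_p) :
  flips M K -> simto K K' -> flips M K'.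
Proof. by case=> S iS SK KK'; exists S => //; apply: simto_trans KK'. Qed.

Lemma flips_three_inv (F : fieldType) n p (M : 'M[F]_n) (K : 'M[F]_p) :
  flips M K -> two_inv K -> three_inv M.
Proof. by case=> S iS SK KK; exists S => //; apply: two_inv_simto KK. Qed.

Lemma flips_dsum (F : fieldType) n p n' p' (M : 'M[F]_n) (K : 'M[F]_p)
    (M' : 'M[F]_n') (K' : 'M[F]_p') :
  flips M K -> flips M' K' -> flips (M :+: M') (K :+: K').
Proof.
case=> S iS SK [S' iS' SK']; exists (S :+: S'); first exact: involutive_dsum.
by rewrite dsum_mul; apply: simto_dsum.
Qed.

(** Since A - i is invertible, P (A - i) = X + Y has a solution P. *)
Lemma flips_frame (F : fieldType) (i : F) n (A X Y : 'M[F]_n) :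
  i ^+ 2 = -1 -> A - i%:M \in unitmx -> X *m Y = - (i *: A) ->
  flips (A :+: (i%:M : 'M_n)) (block_mx Y 1%:M 0 X).
Proof.
move=> i2 Au XY; pose P := (X + Y) *m invmx (A - i%:M).
exists (block_mx P 1%:M (1%:M - P *m P) (- P)); first exact: frame_involution.
by apply: frame_simto => //; rewrite mulmxKV.
Qed.

Lemma simto_scale (F : fieldType) n m a (K : 'M[F]_n) (L : 'M[F]_m) :
  simto K L -> simto (a *: K) (a *: L).
Proof.
case=> G [H [GH HG ->]]; exists G, H; split=> //.
by rewrite -scalemxAr -scalemxAl.
Qed.

Lemma simto_scalar (F : fieldType) n m (a : F) :
  n = m -> simto (a%:M : 'M_n) (a%:M : 'M_m).
Proof. by move=> ->; apply: simto_refl. Qed.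

(** The leftover d appears as a 1 x 1 block, except when d = 1, where it may
    already be part of T (the eigenvalue 1 need not split off). *)
Definition reaches (F : fieldType) n (M : 'M[F]_n) (d : F) :=
  exists p (T : 'M[F]_p), two_inv T /\
    (d = 1 /\ flips M T \/ flips M ((d%:M : 'M_1) :+: T)).

(** With C = - i A conjugate to X Y, where Y = [[d, r], [0, Y']] and X, Y' are
    unipotent, the matrix [[Y, 1], [0, X]] is block triangular with diagonal
    blocks d, Y', X.  It is unipotent if d = 1, and otherwise d is a simple
    eigenvalue that splits off. *)
Lemma reaches_nonscalar (F : fieldType) (i : F) n (A : 'M[F]_n) :
  i ^+ 2 = -1 -> A \in unitmx -> A - i%:M \in unitmx -> ~~ is_scalar_mx A ->
  reaches (A :+: (i%:M : 'M_n)) (\det (- (i *: A))).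
Proof.
move=> i2 Au AiU nsA.
have i0 : i != 0 by rewrite -sqrf_eq0 i2 oppr_eq0 oner_neq0.
set C := - (i *: A); set d := \det C.
have AE : A = i *: C.
  by rewrite /C scalerN scalerA -expr2 i2 scaleN1r opprK.
have nsC : ~~ is_scalar_mx C.
  apply: contraNN nsA => /is_scalar_mxP[c Cc]; apply/is_scalar_mxP.
  by exists (i * c); rewrite AE Cc scale_scalar_mx.
have d0 : d != 0.
  rewrite /d /C -scaleNr detZ mulf_neq0 ?expf_neq0 ?oppr_eq0 //.
  by rewrite -unitfE -unitmxE.
have Cu : C \in unitmx by rewrite unitmxE unitfE.
have [m [r [c [D [sC hS]]]]] := nonscalar_schur Cu nsC d0.
have S1 : \det (schur d r c D) = 1.
  by apply: (mulfI d0); rewrite -det_schur // -(simto_det sC) mulr1.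
have [X' [Y' [uX uY XY]]] := unipotent_factors S1 hS.
have CE := schur_factor d0 XY.
set X := block_mx 1%:M 0 _ X' in CE; set Y := block_mx d%:M r 0 Y' in CE.
set C' := block_mx _ _ _ _ in sC CE.
have sA : simto A (i *: C') by rewrite AE; apply: simto_scale.
have A'u : i *: C' - i%:M \in unitmx.
  have sAi : simto (A - i%:M) (i *: C' - i%:M).
    have := simto_scalarD (- i) sA.
    by rewrite ![_%:M + _]addrC !raddfN.
  by rewrite unitmxE -(simto_det sAi) -unitmxE.
have uX' : unipotent_mx X by apply: unipotent_lblock uX; apply: unipotent1.
have fK : flips (A :+: (i%:M : 'M_n)) (block_mx Y 1%:M 0 X).
  apply: (@flips_simtol _ _ _ _ _ (i *: C' :+: i%:M)).
    exact: simto_dsum sA (simto_scalar i (simto_size sA)).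
  apply: flips_frame => //.
  by rewrite scalerA -expr2 i2 scaleN1r opprK CE.
have [d1|d1] := eqVneq d 1.
  exists _, (block_mx Y 1%:M 0 X); split; last by left.
  apply/unipotent_mx_two_inv/unipotent_ublock => //.
  by rewrite /Y d1; apply: unipotent_ublock uY; apply: unipotent1.
(* V is the identity in the upper right corner, to be cut into two blocks. *)
pose V : 'M[F]_(1 + m) := 1%:M.
pose U := block_mx Y' (dsubmx V) 0 X.
have uU : unipotent_mx U by apply: unipotent_ublock.
exists _, U; split; first exact: unipotent_mx_two_inv.
right; apply: flips_simtor fK _.
apply: simto_trans (unipotent_eigen_split (row_mx r (usubmx V)) d1 uU).
apply: simto_sym; have := simto_blockA d%:M r (usubmx V) 0 Y' (dsubmx V) 0 0 X.
by rewrite vsubmxK col_mx0 row_mx0.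
Qed.

(** Diagonal matrices are indexed by functions on nat, so that the same function
    can be used for matrices of different sizes. *)
Definition diagf (F : fieldType) n (f : nat -> F) : 'M[F]_n :=
  diag_mx (\row_(k < n) f k).

Lemma diagf_mul (F : fieldType) n (f g h : nat -> F) :
  (forall k, (k < n)%N -> f k * g k = h k) ->
  diagf n f *m diagf n g = diagf n h.
Proof.
move=> fg; apply/matrixP => a b; rewrite mul_diag_mx !mxE.
by rewrite -fg ?ltn_ord // mulrnAr.
Qed.

Lemma diagf_const (F : fieldType) n (a : F) : diagf n (fun=> a) = a%:M.
Proof. by apply/matrixP => x y; rewrite !mxE. Qed.

Lemma diagf_add (F : fieldType) m n (f : nat -> F) :
  diagf (m + n) f = diagf m f :+: diagf n (fun k => f (m + k)%N).
Proof.
rewrite /diagf -diag_mx_row; congr diag_mx; apply/rowP => k; rewrite !mxE.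
by case: splitP => j; rewrite mxE => ->.
Qed.

Lemma diagf1 (F : fieldType) (f : nat -> F) : diagf 1 f = (f 0%N)%:M.
Proof. by apply/matrixP => x y; rewrite !mxE !ord1. Qed.

Lemma simto_diagf_recr (F : fieldType) n (f : nat -> F) :
  simto (diagf n.+1 f) (diagf n f :+: (f n)%:M : 'M_(n + 1)).
Proof.
rewrite -addn1 diagf_add diagf1 addn0; exact: simto_refl.
Qed.

(** The entries y k and x k.+1 are inverse to each other, which leaves y m and
    x 0 unpaired. *)
Lemma simto_zigzag (F : fieldType) m (x y : nat -> F) :
  (forall k, (k <= m)%N -> x k != y k) ->
  (forall k, (k < m)%N -> y k * x k.+1 = 1) ->
  exists2 T : 'M[F]_(m + m), two_inv T &
    simto (block_mx (diagf m.+1 y) 1%:M 0 (diagf m.+1 x))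
          (T :+: ((y m)%:M :+: (x 0%N)%:M : 'M_(1 + 1))).
Proof.
move=> xy yx1; exists (diagf m y :+: diagf m (fun k => x k.+1)).
  by apply: two_inv_dsumV; rewrite -(diagf_const m 1); apply: diagf_mul.
apply: (@simto_trans _ _ (m.+1 + m.+1) _ _ (diagf m.+1 y :+: diagf m.+1 x)).
  apply: (@sylvester_split _ _ _ _ _ _ (diagf m.+1 (fun k => (y k - x k)^-1))).
  rewrite -(diagf_const m.+1 1).
  rewrite !(@diagf_mul _ _ _ _ _ (fun _ _ => erefl)).
  apply/matrixP => a b; rewrite !mxE -mulrnDl; congr (_ *+ _).
  have := xy a (ltn_ord a); rewrite eq_sym -subr_eq0 => u.
  by field.
apply: simto_trans (simto_dsum (simto_diagf_recr _ _) (simto_refl _)) _.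
rewrite -[m.+1]add1n diagf_add diagf1.
apply: simto_trans (simto_dsum (simto_refl _) (simto_dsumC _ _)) _.
exact: simto_dsumACA.
Qed.

(** * The scalar case and the theorem *)

(** Here y k = c^(k+1) / s and x k = s / c^k, with y k * x k = c; they are
    distinct because s^2 is not c^(2k+1). *)
Lemma scalar_zigzag (F : fieldType) (i : F) m (A : 'M[F]_m.+1) (c s : F) :
  i ^+ 2 = -1 -> A - i%:M \in unitmx -> - (i *: A) = c%:M -> c != 0 -> s != 0 ->
  (forall k, (k <= m)%N -> s ^+ 2 != c ^+ (k.*2.+1)) ->
  exists2 T : 'M[F]_(m + m), two_inv T &
    flips (A :+: (i%:M : 'M_m.+1))
          (T :+: ((c ^+ m.+1 / s)%:M :+: s%:M : 'M_(1 + 1))).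
Proof.
move=> i2 AiU Cc c0 s0 hs.
pose x k := s / c ^+ k; pose y k := c ^+ k.+1 / s.
have [k km|k km|T TT sT] := @simto_zigzag _ m x y.
- apply: contraNneq (hs k km) => e.
  have ck : c ^+ k != 0 by rewrite expf_neq0.
  have -> : s ^+ 2 = x k * (s * c ^+ k) by rewrite /x; field.
  rewrite e /y -addnn -addSn exprD; apply/eqP; field; exact: s0.
- by rewrite /x /y mulrA divfK // divff // expf_neq0.
- have x0 : s = x 0%N by rewrite /x expr0 divr1.
  exists T => //; rewrite -/(y m) x0.
  apply: flips_simtor sT; apply: flips_frame => //.
  rewrite Cc -diagf_const; apply: diagf_mul => k _.
  rewrite /x /y exprS; field; rewrite s0 expf_neq0 //.
Qed.

(** The choice s = 1 works unless c^(2j+1) = 1 for some j < n.  In that case d,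
    which is a power of c, has odd order and so d^2 = 1 or -1 forces d = 1, and
    s = i works since c^(2k+1) = -1 is impossible for an element of odd order.  The
    unpaired entries 1 / i and i are then inverse to each other. *)
Lemma reaches_scalar (F : fieldType) (i : F) n (A : 'M[F]_n) :
  2%N \notin [pchar F] -> i ^+ 2 = -1 -> A - i%:M \in unitmx -> is_scalar_mx A ->
  \det (- (i *: A)) ^+ 2 = 1 \/ \det (- (i *: A)) ^+ 2 = -1 ->
  reaches (A :+: (i%:M : 'M_n)) (\det (- (i *: A))).
Proof.
move=> ch2 i2 AiU /is_scalar_mxP[a Aa].
have i0 : i != 0 by rewrite -sqrf_eq0 i2 oppr_eq0 oner_neq0.
have N11 : (1 : F) != -1.
  by rewrite -subr_eq0 opprK; apply: contra ch2 => e; rewrite inE /=.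
case: n A Aa AiU => [|m] A Aa AiU.
  move=> _; exists _, (A :+: (i%:M : 'M_0)); split.
    by apply: two_inv_involutive; rewrite /involutive_mx !flatmx0.
  left; rewrite det_mx00; split=> //.
  exists 1%:M; first exact: involutive1.
  by rewrite mul1mx; apply: simto_refl.
pose c := - (i * a).
have Cc : - (i *: A) = c%:M by rewrite Aa scale_scalar_mx -raddfN.
rewrite Cc det_scalar; set d := c ^+ m.+1 => d2.
have c0 : c != 0.
  have : d != 0.
    rewrite -sqrf_eq0; case: d2 => ->; rewrite ?oppr_eq0 oner_neq0 //.
  by apply: contra_neq => c0; rewrite /d c0 expr0n.
have [/existsP[[j jm] /= /eqP cj]|] := boolP [exists j : 'I_m.+1, c ^+ (j.*2.+1) == 1].
  have d1 : d = 1.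
    have dj : d ^+ (j.*2.+1) = 1 by rewrite /d exprAC cj expr1n.
    have dE : (d ^+ 2) ^+ j * d = 1 by rewrite -exprM mul2n -exprSr.
    case: d2 => d2; rewrite d2 in dE; first by move: dE; rewrite expr1n mul1r.
    case/eqP: N11; rewrite -d2.
    have : (d ^+ (j.*2.+1)) ^+ 2 = 1 by rewrite dj expr1n.
    rewrite exprAC d2 -signr_odd /= odd_double expr1 => e; exact/esym.
  have [k km|T TT fT] := scalar_zigzag i2 AiU Cc c0 i0.
    rewrite i2; apply: contra N11 => /eqP ck.
    have : (c ^+ (k.*2.+1)) ^+ (j.*2.+1) = 1 by rewrite exprAC cj expr1n.
    by rewrite -ck -signr_odd /= odd_double expr1 => ->.
  exists _, (T :+: ((d / i)%:M :+: i%:M : 'M_(1 + 1))); split; last by left.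
  apply: two_inv_dsum => //; apply: two_inv_dsumV.
  by rewrite -scalar_mxM d1 divfK.
rewrite negb_exists => /forallP cN.
have [k km|T TT fT] := scalar_zigzag i2 AiU Cc c0 (oner_neq0 F).
  have := cN (Ordinal (km : (k < m.+1)%N)); rewrite /= expr1n eq_sym; exact.
exists _, (T :+: (1%:M : 'M_1)); split.
  by apply: two_inv_dsum => //; apply/two_inv_involutive/involutive1.
right; apply: flips_simtor fT _; rewrite divr1.
apply: simto_trans (simto_dsumC _ _) _.
apply: simto_trans (simto_sym (simto_dsumA _ _ _)) _.
exact: simto_dsum (simto_refl _) (simto_dsumC _ _).
Qed.

Lemma reaches_det (F : fieldType) (i : F) n (A : 'M[F]_n) :
  2%N \notin [pchar F] -> i ^+ 2 = -1 -> A \in unitmx -> A - i%:M \in unitmx ->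
  \det (- (i *: A)) ^+ 2 = 1 \/ \det (- (i *: A)) ^+ 2 = -1 ->
  reaches (A :+: (i%:M : 'M_n)) (\det (- (i *: A))).
Proof.
move=> ch2 i2 Au AiU d2.
have [sA|nsA] := boolP (is_scalar_mx A); first exact: reaches_scalar.
exact: reaches_nonscalar.
Qed.

Lemma three_inv_even (F : fieldType) n (M : 'M[F]_n) d :
  d ^+ 2 = 1 -> reaches M d -> three_inv M.
Proof.
move=> d2 [p [T [TT]]]; case=> [[_ fT]|fT]; apply: (flips_three_inv fT) => //.
by apply: two_inv_dsum => //; apply/two_inv_involutive/involutive_scalar.
Qed.

(** The spare i becomes -d after multiplication by i d, which is 1 or -1 as
    (i d)^2 = 1; and -d is the inverse of d. *)
Lemma three_inv_odd (F : fieldType) (i : F) n (M : 'M[F]_n) d :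
  2%N \notin [pchar F] -> i ^+ 2 = -1 -> d ^+ 2 = -1 -> reaches M d ->
  three_inv (M :+: (i%:M : 'M_1)).
Proof.
move=> ch2 i2 d2 [p [T [TT]]]; case=> [[d1 _]|fT].
  move: d2; rewrite d1 expr1n => e.
  by case/negP: ch2; rewrite inE /= mulr2n {1}e addNr.
have fi : flips (i%:M : 'M[F]_1) ((- d)%:M : 'M_1).
  exists (i * d)%:M.
    by apply: involutive_scalar; rewrite exprMn i2 d2 mulrNN mulr1.
  rewrite -scalar_mxM mulrAC -expr2 i2 mulN1r; exact: simto_refl.
apply: (flips_three_inv (K := T :+: (d%:M :+: (- d)%:M : 'M_(1 + 1)))).
  apply: flips_simtor (flips_dsum fT fi) _.
  apply: simto_trans (simto_dsum (simto_dsumC _ _) (simto_refl _)) _.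
  exact: simto_sym (simto_dsumA _ _ _).
apply: two_inv_dsum => //; apply: two_inv_dsumV.
by rewrite -scalar_mxM mulrN -expr2 d2 opprK.
Qed.

(** Multiplying one half by -1 gives i and -i, which are inverse to each
    other. *)
Lemma three_inv_scalar_even (F : fieldType) (i : F) h :
  i ^+ 2 = -1 -> three_inv (i%:M : 'M_(h + h)).
Proof.
move=> i2; exists (1%:M :+: (-1)%:M).
  by apply: involutive_dsum; apply: involutive_scalar; rewrite ?expr1n ?sqrrN ?expr1n.
rewrite scalar_mx_block dsum_mul; apply: two_inv_dsumV.
by rewrite -!scalar_mxM mul1r mulN1r mulrN -expr2 i2 opprK.
Qed.

Lemma two_inv_det (F : fieldType) n (K : 'M[F]_n) : two_inv K -> \det K ^+ 2 = 1.
Proof.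
case=> S [T [SS TT ->]]; rewrite det_mulmx exprMn !expr2 -!det_mulmx.
by rewrite SS TT mulmx1 det1.
Qed.

Theorem theorem1p11 (F : fieldType) (charF : 2%N \notin [pchar F])
    (i : F) (i2 : i ^+ 2 = -1) (n r : nat) (A : 'M[F]_n)
    (unitA : A \in unitmx) (ler : (n <= r)%N)
    (detA : i ^+ r * \det A = 1 \/ i ^+ r * \det A = -1) :
  exists S1 S2 S3 : 'M[F]_(n + r),
    [/\ mx_involution S1, mx_involution S2, mx_involution S3
      & mx_dsum A (i%:M : 'M[F]_r) = S1 *m S2 *m S3].
Proof.
suff: three_inv (mx_dsum A (i%:M : 'M[F]_r)).
  have unit_inv (S : 'M[F]_(n + r)) : involutive_mx S -> mx_involution S.
    by move=> SS; split=> //; case/mulmx1_unit: SS.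
  case=> S SS [S2 [S3 [i2' i3 e]]]; exists S, S2, S3; split; try exact: unit_inv.
  by rewrite -mulmxA -e mulmxA SS mul1mx.
rewrite /mx_dsum.
have i0 : i != 0 by rewrite -sqrf_eq0 i2 oppr_eq0 oner_neq0.
have [n1 [n2 [N1 [N2 [sN nN1 uN2]]]]] := fitting_split (A - i%:M).
have sA : simto A ((i%:M + N1) :+: (i%:M + N2)).
  have := simto_scalarD i sN.
  by rewrite addrC subrK scalar_mx_block add_block_mx !addr0.
pose U := 1%:M - i *: N1.
have TU : two_inv U.
  apply: unipotent_mx_two_inv; rewrite /unipotent_mx /U addrC addKr.
  case: nN1 => k Nk; exists k.
  have -> : - (i *: N1) = (- i)%:M * N1 by rewrite -mulmxE mul_scalar_mx scaleNr.
  rewrite exprMn_comm; last exact: esym (scalar_mxC _ _).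
  by rewrite Nk mulr0.
have A1E : i%:M + N1 = i *: U.
  by rewrite scalerBr scalerA -expr2 i2 scaleN1r opprK scalemx1.
set A2 := i%:M + N2 in sA.
have A2i : A2 - i%:M \in unitmx by rewrite /A2 addrC addKr.
have detE : \det A = i ^+ n1 * \det U * \det A2.
  by rewrite (simto_det sA) det_ublock A1E detZ.
have A2u : A2 \in unitmx.
  rewrite unitmxE unitfE; apply: contraTneq unitA => e.
  by rewrite unitmxE detE e mulr0 unitr0.
pose q := (r - n)%N.
have rE : r = (n1 + (n2 + q))%N.
  by rewrite addnA -(simto_size sA) subnKC.
(* Squaring removes the signs of the hypothesis and of det U. *)
have d2 : \det (- (i *: A2)) ^+ 2 = (-1) ^+ q.
  have : (i ^+ r * \det A) ^+ 2 = 1.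
    by case: detA => ->; rewrite ?sqrrN expr1n.
  rewrite detE -scaleNr detZ !exprMn (two_inv_det TU) mulr1.
  rewrite ![(_ ^+ _) ^+ 2]exprAC sqrrN i2 rE !exprD => e.
  have n1n1 : (-1 : F) ^+ n1 * (-1) ^+ n1 = 1 by rewrite -exprMn mulrNN mulr1 expr1n.
  have qq : (-1 : F) ^+ q * (-1) ^+ q = 1 by rewrite -exprMn mulrNN mulr1 expr1n.
  move: n1n1 qq e; move: ((-1) ^+ n1) ((-1) ^+ n2) ((-1) ^+ q) (\det A2 ^+ 2).
  move=> a b c D aa cc e; rewrite -[RHS]mulr1 -e.
  transitivity ((a * a) * (c * c) * (b * D)); first by rewrite aa cc !mul1r.
  by ring.
have sM : simto (A :+: (i%:M : 'M_r))
    (i *: U :+: (i%:M : 'M_n1) :+: (A2 :+: (i%:M : 'M_n2) :+: (i%:M : 'M_q))).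
  have si : simto (i%:M : 'M_r) ((i%:M : 'M_n1) :+: ((i%:M : 'M_n2) :+: (i%:M : 'M_q))).
    by rewrite -!scalar_mx_block; apply: simto_scalar.
  rewrite A1E in sA; apply: simto_trans (simto_dsum sA si) _.
  apply: simto_trans (simto_dsumACA _ _ _ _) _.
  exact: simto_dsum (simto_refl _) (simto_dsumA _ _ _).
apply: three_inv_simto sM _; apply: three_inv_dsum; first exact: three_inv_swap.
have reach : reaches (A2 :+: (i%:M : 'M_n2)) (\det (- (i *: A2))).
  apply: reaches_det => //; rewrite d2 -signr_odd.
  by case: (odd q); [right | left].
rewrite -signr_odd in d2; have := odd_double_half q; rewrite -addnn.
case: (odd q) d2 => /= d2 qE; last first.
  apply: (three_inv_simto (simto_dsum (simto_refl _) (simto_scalar i (esym qE)))).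
  rewrite add0n; apply: three_inv_dsum (three_inv_scalar_even _ i2).
  exact: three_inv_even reach.
apply: (three_inv_simto (simto_dsum (simto_refl _) (simto_scalar i (esym qE)))).
rewrite scalar_mx_block; apply: three_inv_simto (simto_dsumA _ _ _) _.
apply: three_inv_dsum (three_inv_scalar_even _ i2).
exact: three_inv_odd reach.
Qed.
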